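(* Let ${}^{0}Y_{r,n}^{f}$ be the nil Yokonuma-Hecke algebra over $\mathbb{K}$. The Jacobson radical of ${}^{0}Y_{r,n}^{f}$ is the two-sided ideal generated by the elements $T_w$ for all $w\in\mathfrak{S}_n$ with $w\neq 1$. Moreover, up to isomorphism there are exactly $r^n$ simple modules of ${}^{0}Y_{r,n}^{f}$, and all of them are of dimension $1$ over $\mathbb{K}$.
   Context: Let $r,n\ge 1$ be integers and let $\mathbb{K}$ be an algebraically closed field of characteristic $p\ge 0$ such that $p$ does not divide $r$. $\mathfrak{S}_n$ is the symmetric group and $s_i$ is the transposition $(i,i+1)$. The nil Yokonuma-Hecke algebra ${}^{0}Y_{r,n}^{f}$ is the associative unital $\mathbb{K}$-algebra generated by $T_1,\ldots,T_{n-1}$ and $t_1,\ldots,t_n$ subject to the relations: $t_i^r=1$ for $1\le i\le n$; $t_it_j=t_jt_i$ for $1\le i,j\le n$; $T_it_j=t_{s_i(j)}T_i$ for $1\le i\le n-1$, $1\le j\le n$; $T_iT_j=T_jT_i$ for $1\le i,j\le n-1$ with $|i-j|\ge 2$; $T_iT_{i+1}T_i=T_{i+1}T_iT_{i+1}$ for $1\le i\le n-2$; and $T_i^2=0$ for $1\le i\le n-1$. For $w\in\mathfrak{S}_n$ with reduced expression $w=s_{i_1}\cdots s_{i_m}$, set $T_w:=T_{i_1}\cdots T_{i_m}$ (independent of the reduced expression). *)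

(* Defs.v *)
From HB Require Import structures.
From mathcomp Require Import all_boot all_order all_algebra all_fingroup.
From mathcomp Require Import generic_quotient.
From mathcomp Require Import finmap monalg.
From mathcomp Require Import mathcomp_extra boolp classical_sets.

Set Implicit Arguments.
Unset Strict Implicit.
Unset Printing Implicit Defensive.

Import GRing.Theory.

Local Open Scope classical_set_scope.
Local Open Scope ring_scope.

Section Modules.
Variable A : nzRingType.
Implicit Types M N : lmodType A.

Definition submodule M (N : set M) : Prop :=
  [/\ N 0, forall x y, N x -> N y -> N (x + y)
         & forall (a : A) x, N x -> N (a *: x)].

Definition simple_module M : Prop :=
  (exists x : M, x != 0) /\
  forall N : set M, submodule N -> N = [set 0] \/ N = setT.

Definition module_iso M N : Prop := exists f : {linear M -> N}, bijective f.

Definition num_simple_modules (m : nat) : Prop :=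
  exists S : 'I_m -> lmodType A,
    [/\ forall i, simple_module (S i),
        forall i j, module_iso (S i) (S j) -> i = j
      & forall M, simple_module M -> exists i, module_iso M (S i)].

Definition left_ideal (I : set A) : Prop := @submodule A^o I.

Definition maximal_left_ideal (I : set A) : Prop :=
  [/\ left_ideal I, I <> setT
    & forall J, left_ideal J -> I `<=` J -> J = I \/ J = setT].

Definition jacobson_radical : set A :=
  \bigcap_(I in maximal_left_ideal) I.

Definition two_sided_ideal (I : set A) : Prop :=
  [/\ I 0, forall x y, I x -> I y -> I (x + y),
      forall a x, I x -> I (a * x) & forall a x, I x -> I (x * a)].

Definition ideal_gen (S : set A) : set A := smallest two_sided_ideal S.

Lemma ideal_gen_ideal (S : set A) : two_sided_ideal (ideal_gen S).
Proof.
split=> [J [[]]//|x y Sx Sy J JI|a x Sx J JI|a x Sx J JI].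
- by case: (JI.1) => _ + _ _; apply; [exact: Sx|exact: Sy].
- by case: (JI.1) => _ _ + _; apply; exact: Sx.
- by case: (JI.1) => _ _ _; apply; exact: Sx.
Qed.

Lemma ker_ideal (B : nzRingType) (f : {rmorphism A -> B}) :
  two_sided_ideal [set x | f x = 0].
Proof.
split=> /= [|x y fx fy|a x fx|a x fx]; first exact: rmorph0.
- by rewrite rmorphD fx fy addr0.
- by rewrite rmorphM fx mulr0.
- by rewrite rmorphM fx mul0r.
Qed.

End Modules.

Arguments num_simple_modules : clear implicits.
Arguments jacobson_radical : clear implicits.

(* An A-module is a K-vector space through c |-> c%:A, where K -> A is the
   structure map of the K-algebra A. *)
Definition has_dim (K : fieldType) (A : algType K) (M : lmodType A) (d : nat)
    : Prop :=
  exists b : 'I_d -> M, forall x : M,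
    exists! c : {ffun 'I_d -> K}, x = \sum_(i < d) (c i)%:A *: b i.

(* MathComp rings are nontrivial, so an algebra is only quotiented by a proper
   ideal. *)
Record properIdeal (A : nzRingType) := ProperIdeal {
  properIdeal_set :> A -> Prop;
  properIdealP : two_sided_ideal properIdeal_set;
  properIdeal1 : ~ properIdeal_set 1
}.

Section Quotient.
Variables (K : fieldType) (A : algType K) (I : properIdeal A).

Definition ideal_eqv (x y : A) : bool := `[< I (x - y) >].

Let I0 : I 0. Proof. by have [] := properIdealP I. Qed.
Let ID x y : I x -> I y -> I (x + y).
Proof. by have [_ + _ _] := properIdealP I; apply. Qed.
Let IMl a x : I x -> I (a * x).
Proof. by have [_ _ + _] := properIdealP I; apply. Qed.
Let IMr a x : I x -> I (x * a).
Proof. by have [_ _ _] := properIdealP I; apply. Qed.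
Let IN x : I x -> I (- x). Proof. by move=> /(@IMl (-1)); rewrite mulN1r. Qed.

Lemma ideal_eqv_refl : reflexive ideal_eqv.
Proof. by move=> x; apply/asboolP; rewrite subrr. Qed.

Lemma ideal_eqv_sym : symmetric ideal_eqv.
Proof.
by move=> x y; apply/asboolP/asboolP => /IN; rewrite opprB.
Qed.

Lemma ideal_eqv_trans : transitive ideal_eqv.
Proof.
move=> y x z /asboolP xy /asboolP yz; apply/asboolP.
by rewrite -(subrKA y); exact: ID.
Qed.

Canonical ideal_equiv :=
  EquivRel ideal_eqv ideal_eqv_refl ideal_eqv_sym ideal_eqv_trans.

Definition quot_alg := {eq_quot ideal_equiv}%qT.
HB.instance Definition _ := Choice.on quot_alg.
HB.instance Definition _ := EqQuotient.on quot_alg.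

Definition quot_pi (x : A) : quot_alg := (\pi_quot_alg x)%qT.

Lemma quot_piE x y : quot_pi x = quot_pi y <-> I (x - y).
Proof. by rewrite /quot_pi; split=> [/eqP|H]; last apply/eqP;
  rewrite ?piE; [move/asboolP|apply/asboolP]. Qed.

Let rep (u : quot_alg) : A := repr u.
Let repK u : quot_pi (rep u) = u. Proof. exact: reprK. Qed.
Let rep_pi x : I (rep (quot_pi x) - x). Proof. by apply/quot_piE. Qed.

Let q0 := quot_pi 0.
Let q1 := quot_pi 1.
Let qopp u := quot_pi (- rep u).
Let qadd u v := quot_pi (rep u + rep v).
Let qmul u v := quot_pi (rep u * rep v).
Let qscale (c : K) u := quot_pi (c *: rep u).

Let qoppE x : qopp (quot_pi x) = quot_pi (- x).
Proof. by apply/quot_piE; rewrite -opprD; exact/IN/rep_pi. Qed.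
Let qaddE x y : qadd (quot_pi x) (quot_pi y) = quot_pi (x + y).
Proof. by apply/quot_piE; rewrite opprD addrACA; apply: ID; exact: rep_pi. Qed.
Let qmulE x y : qmul (quot_pi x) (quot_pi y) = quot_pi (x * y).
Proof.
apply/quot_piE; set a := rep _; set b := rep _.
have -> : a * b - x * y = a * (b - y) + (a - x) * y.
  by rewrite mulrBr mulrBl subrKA.
by apply: ID; [apply: IMl|apply: IMr]; exact: rep_pi.
Qed.
Let qscaleE c x : qscale c (quot_pi x) = quot_pi (c *: x).
Proof.
apply/quot_piE; rewrite -scalerBr -[_ - _]mul1r scalerAl; apply: IMl; exact: rep_pi.
Qed.

Let ind (P : quot_alg -> Prop) : (forall x, P (quot_pi x)) -> forall u, P u.
Proof. by move=> Ppi u; rewrite -(repK u). Qed.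

Let qaddA : associative qadd.
Proof. by do 3!elim/ind=> ?; rewrite !qaddE addrA. Qed.
Let qaddC : commutative qadd.
Proof. by do 2!elim/ind=> ?; rewrite !qaddE addrC. Qed.
Let qadd0 : left_id q0 qadd.
Proof. by elim/ind=> ?; rewrite qaddE add0r. Qed.
Let qaddN : left_inverse q0 qopp qadd.
Proof. by elim/ind=> ?; rewrite qoppE qaddE addNr. Qed.

HB.instance Definition _ :=
  GRing.isZmodule.Build quot_alg qaddA qaddC qadd0 qaddN.

Let qmulA : associative qmul.
Proof. by do 3!elim/ind=> ?; rewrite !qmulE mulrA. Qed.
Let qmul1l : left_id q1 qmul.
Proof. by elim/ind=> ?; rewrite qmulE mul1r. Qed.
Let qmul1r : right_id q1 qmul.
Proof. by elim/ind=> ?; rewrite qmulE mulr1. Qed.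
Let qmulDl : left_distributive qmul +%R.
Proof.
by do 3!elim/ind=> ?; rewrite [(_ + _)%R]qaddE !qmulE [RHS]qaddE mulrDl.
Qed.
Let qmulDr : right_distributive qmul +%R.
Proof.
by do 3!elim/ind=> ?; rewrite [(_ + _)%R]qaddE !qmulE [RHS]qaddE mulrDr.
Qed.
Let q1_neq0 : q1 != 0.
Proof. by apply/eqP => /quot_piE; rewrite subr0; exact: properIdeal1. Qed.

HB.instance Definition _ := GRing.Zmodule_isNzRing.Build quot_alg
  qmulA qmul1l qmul1r qmulDl qmulDr q1_neq0.

Let qscaleA a b u : qscale a (qscale b u) = qscale (a * b) u.
Proof. by elim/ind: u => ?; rewrite !qscaleE scalerA. Qed.
Let qscale1 : left_id 1 qscale.
Proof. by elim/ind=> ?; rewrite qscaleE scale1r. Qed.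
Let qscaleDr : right_distributive qscale +%R.
Proof.
by move=> a; do 2!elim/ind=> ?; rewrite [(_ + _)%R]qaddE !qscaleE [RHS]qaddE
  scalerDr.
Qed.
Let qscaleDl u : {morph qscale^~ u : a b / a + b}.
Proof.
by elim/ind: u => ? a b; rewrite !qscaleE [RHS]qaddE scalerDl.
Qed.

HB.instance Definition _ := GRing.Zmodule_isLmodule.Build K quot_alg
  qscaleA qscale1 qscaleDr qscaleDl.

Let qscaleAl (c : K) (u v : quot_alg) : c *: (u * v) = (c *: u) * v.
Proof.
change (qscale c (qmul u v) = qmul (qscale c u) v).
by elim/ind: u => x; elim/ind: v => y; rewrite !(qmulE, qscaleE) scalerAl.
Qed.
Let qscaleAr (c : K) (u v : quot_alg) : c *: (u * v) = u * (c *: v).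
Proof.
change (qscale c (qmul u v) = qmul u (qscale c v)).
by elim/ind: u => x; elim/ind: v => y; rewrite !(qmulE, qscaleE) scalerAr.
Qed.

HB.instance Definition _ := GRing.Lmodule_isLalgebra.Build K quot_alg qscaleAl.
HB.instance Definition _ := GRing.Lalgebra_isAlgebra.Build K quot_alg qscaleAr.

Fact quot_pi_zmod_morphism : zmod_morphism quot_pi.
Proof.
move=> x y; change (quot_pi (x - y) = qadd (quot_pi x) (qopp (quot_pi y))).
by rewrite qoppE qaddE.
Qed.
Fact quot_pi_monoid_morphism : monoid_morphism quot_pi.
Proof. by split=> // x y; rewrite -qmulE. Qed.
Fact quot_pi_scalable : scalable quot_pi.
Proof. by move=> c x; rewrite -qscaleE. Qed.

HB.instance Definition _ :=
  GRing.isZmodMorphism.Build A quot_alg quot_pi quot_pi_zmod_morphism.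
HB.instance Definition _ :=
  GRing.isMonoidMorphism.Build A quot_alg quot_pi quot_pi_monoid_morphism.
HB.instance Definition _ :=
  GRing.isScalable.Build K A quot_alg *:%R quot_pi quot_pi_scalable.

Lemma quot_pi_eq0 x : quot_pi x = 0 <-> I x.
Proof. by have := quot_piE x 0; rewrite subr0. Qed.

Lemma quot_pi_surj (u : quot_alg) : exists x, u = quot_pi x.
Proof. by exists (rep u); rewrite repK. Qed.

End Quotient.

Section FreeAlgebra.
Variables (K : fieldType) (X : choiceType).

Definition free_alg := {malg K[{fmonom X}]}.

HB.instance Definition _ := GRing.Lalgebra.on free_alg.

Fact free_alg_scalerAr (c : K) (x y : free_alg) : c *: (x * y) = x * (c *: y).
Proof.
have malgCr (z : free_alg) : z * c%:MP = c *: z.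
  rewrite malgM_def malgZ_def fgmulgU; apply/eq_bigr => k _.
  by rewrite mulm1 mulrC.
by rewrite -(mul_malgC c y) mulrA malgCr scalerAl.
Qed.

HB.instance Definition _ :=
  GRing.Lalgebra_isAlgebra.Build K free_alg free_alg_scalerAr.

End FreeAlgebra.

Definition free_gen (K : fieldType) (X : choiceType) (x : X)
  : free_alg K X := << fmu x >>.

Section Evaluation.
Variables (K : fieldType) (X : choiceType) (f : X -> K).

Definition word_eval (w : {fmonom X}) : K := \prod_(x <- fmonom_val w) f x.

Fact word_eval_mmorphism : mmorphism word_eval.
Proof.
split=> [x y|]; rewrite /word_eval; last by rewrite fm1 big_nil.
by rewrite fmM big_cat.
Qed.

HB.instance Definition _ :=
  isMultiplicative.Build {fmonom X} K word_eval word_eval_mmorphism.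

Lemma free_alg_eval : exists ev : {rmorphism free_alg K X -> K},
  forall x, ev (free_gen K x) = f x.
Proof.
exists (mmap idfun word_eval) => x; rewrite /free_gen.
by rewrite /= mmapU /= mul1r /word_eval fmuE big_seq1.
Qed.

End Evaluation.

Section SimpleReflections.
Variable n : nat.

Lemma simple_refl_ltl (i : 'I_n.-1) : (i < n)%N.
Proof. exact: leq_trans (ltn_ord i) (leq_pred n). Qed.

Lemma simple_refl_ltr (i : 'I_n.-1) : (i.+1 < n)%N.
Proof. by rewrite -ltn_predRL. Qed.

Definition simple_refl (i : 'I_n.-1) : 'S_n :=
  tperm (Ordinal (simple_refl_ltl i)) (Ordinal (simple_refl_ltr i)).

(* In s_(i_1) ... s_(i_m) the rightmost factor acts first, while the product of
   'S_n composes from left to right; hence rev. *)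
Definition word_perm (s : seq 'I_n.-1) : 'S_n :=
  (\prod_(i <- rev s) simple_refl i)%g.

Definition reduced_word (w : 'S_n) (s : seq 'I_n.-1) : Prop :=
  word_perm s = w /\
  forall s', word_perm s' = w -> (size s <= size s')%N.

(* The defining relations, between elements of any ring A with chosen families
   T and t; the ordinals number the generators from 0. *)
Inductive nilYH_rel (r : nat) (A : nzRingType)
    (T : 'I_n.-1 -> A) (t : 'I_n -> A) : A -> A -> Prop :=
| nilYH_tX j :
    nilYH_rel r T t (t j ^+ r) 1
| nilYH_tt j k :
    nilYH_rel r T t (t j * t k) (t k * t j)
| nilYH_Tt i j :
    nilYH_rel r T t (T i * t j) (t (simple_refl i j) * T i)
| nilYH_TT (i k : 'I_n.-1) : (i.+1 < k)%N || (k.+1 < i)%N ->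
    nilYH_rel r T t (T i * T k) (T k * T i)
| nilYH_braid (i k : 'I_n.-1) : k = i.+1 :> nat ->
    nilYH_rel r T t (T i * T k * T i) (T k * T i * T k)
| nilYH_T2 i :
    nilYH_rel r T t (T i ^+ 2) 0.

Lemma nilYH_rel_morph r (A B : nzRingType) (f : {rmorphism A -> B}) T t x y :
  nilYH_rel r T t x y -> nilYH_rel r (f \o T) (f \o t) (f x) (f y).
Proof.
case=> [j|j k|i j|i k ik|i k ik|i];
  rewrite ?rmorphXn ?rmorphM ?rmorph0 ?rmorph1.
- exact: (nilYH_tX r (f \o T) (f \o t) j).
- exact: (nilYH_tt r (f \o T) (f \o t) j k).
- exact: (nilYH_Tt r (f \o T) (f \o t) i j).
- exact: (nilYH_TT r (f \o T) (f \o t) ik).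
- exact: (nilYH_braid r (f \o T) (f \o t) ik).
- exact: (nilYH_T2 r (f \o T) (f \o t) i).
Qed.

Lemma nilYH_rel_lift r (A B : nzRingType) (f : {rmorphism A -> B}) T t u v :
  nilYH_rel r (f \o T) (f \o t) u v ->
  exists x y, [/\ nilYH_rel r T t x y, u = f x & v = f y].
Proof.
case=> [j|j k|i j|i k ik|i k ik|i].
- exists (t j ^+ r), 1; rewrite rmorphXn rmorph1; split=> //; by constructor.
- exists (t j * t k), (t k * t j); rewrite !rmorphM; split=> //; by constructor.
- exists (T i * t j), (t (simple_refl i j) * T i); rewrite !rmorphM.
  by split=> //; constructor.
- exists (T i * T k), (T k * T i); rewrite !rmorphM; split=> //; by constructor.
- exists (T i * T k * T i), (T k * T i * T k); rewrite !rmorphM.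
  by split=> //; constructor.
- exists (T i ^+ 2), 0; rewrite rmorphXn rmorph0; split=> //; by constructor.
Qed.

Lemma nilYH_rel_trivial r (A : nzRingType) (T : 'I_n.-1 -> A) (t : 'I_n -> A) :
  (forall i, T i = 0) -> (forall j, t j = 1) ->
  forall x y, nilYH_rel r T t x y -> x = y.
Proof.
move=> T0 t1 x y; case=> *; rewrite ?T0 ?t1.
all: by rewrite ?expr1n ?expr0n ?mulr0 ?mul0r ?mulr1.
Qed.

End SimpleReflections.

Section NilYokonumaHecke.
Variables (K : fieldType) (r n : nat).

(* inl i stands for T_i and inr j for t_j. *)
Definition nilYH_gen : choiceType := ('I_n.-1 + 'I_n)%type.

Definition free_T (i : 'I_n.-1) : free_alg K nilYH_gen := free_gen K (inl i).
Definition free_t (j : 'I_n) : free_alg K nilYH_gen := free_gen K (inr j).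

Definition nilYH_relators : set (free_alg K nilYH_gen) :=
  [set z | exists x y, nilYH_rel r free_T free_t x y /\ z = x - y].

Fact nilYH_ideal_proper : ~ ideal_gen nilYH_relators 1.
Proof.
pose f (g : nilYH_gen) : K := if g is inl _ then 0 else 1.
have [ev evE] := free_alg_eval f.
move=> I1; suff : ev 1 = 0 by move/eqP; rewrite rmorph1 oner_eq0.
apply: (I1 [set x | ev x = 0]); split; first exact: ker_ideal.
move=> _ [x [y [xy ->]]] /=; rewrite rmorphB; apply/eqP; rewrite subr_eq0.
apply/eqP; apply: nilYH_rel_trivial (nilYH_rel_morph ev xy).
- by move=> i; exact: evE.
- by move=> j; exact: evE.
Qed.

Definition nilYH_ideal : properIdeal (free_alg K nilYH_gen) :=
  ProperIdeal (ideal_gen_ideal nilYH_relators) nilYH_ideal_proper.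

Definition nilYH : algType K := quot_alg nilYH_ideal.

Definition nilYH_T (i : 'I_n.-1) : nilYH := quot_pi nilYH_ideal (free_T i).
Definition nilYH_t (j : 'I_n) : nilYH := quot_pi nilYH_ideal (free_t j).

Lemma nilYH_relP x y : nilYH_rel r nilYH_T nilYH_t x y -> x = y.
Proof.
move=> /(@nilYH_rel_lift _ _ _ _ (quot_pi nilYH_ideal)) [u [v [uv -> ->]]].
by apply/quot_piE => J [_]; apply; exists u, v.
Qed.

(* x = T_w, computed from some reduced expression of w. *)
Definition is_Tw (w : 'S_n) (x : nilYH) : Prop :=
  exists2 s, reduced_word w s & x = \prod_(i <- s) nilYH_T i.

End NilYokonumaHecke.

(* Main.v *)
From HB Require Import structures.
From mathcomp Require Import monalg generic_quotient separable cyclotomic zify.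
Require Import Defs.
From mathcomp Require Import all_boot all_order all_algebra all_fingroup.
From mathcomp Require Import boolp classical_sets.

Set Implicit Arguments.
Unset Strict Implicit.
Unset Printing Implicit Defensive.

Import GRing.Theory.
Local Open Scope classical_set_scope.
Local Open Scope ring_scope.

(** Write [Y] for the algebra and [I] for the ideal generated by the [T i]; it
is also the ideal generated by the [T_w] with [w != 1], because a nontrivial
reduced word has a first letter and each [T i] is itself a [T_w]
([ideal_gen_Tw]).  Modulo [I] only the commuting [t j] of order dividing [r]
remain, and they are diagonalizable since [r] is invertible in [K]; while [I] is
nilpotent, because the [T i] can be moved past the [t j] and long words in the
[T i] vanish.  So [I] is the radical, and the simple modules are the characters
of the torus generated by the [t j].

[I] lies in the radical.  Every word of length more than [m ^ 2] in [m] nilpotent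
generators satisfying the braid relations is zero ([nilCoxeter_nilpotent]): a
nonzero word can be rewritten, without changing its length, as a product of [m]
descending runs, the [k]-th of which has at most [k] letters.  If [L] is a
maximal left ideal, the [x] with every [T i * x] in [L] form a left ideal
containing [L].  It is everything, as otherwise it is [L] and, starting from [1],
one may keep multiplying on the left by some [T i] without ever entering [L], so
that arbitrarily long words are nonzero ([maximal_left_ideal_T]).

The radical lies in [I].  Let [z] enumerate the [r]-th roots of unity.  For each
[n]-tuple [a] of indices there is a character [chi a] of [Y] killing the [T i] and
sending [t j] to [z (a j)] ([nilYH_character]); its kernel is a maximal left
ideal.  Lagrange interpolation at the roots of unity yields elements [e a] of sum
[1] with [t j * e a = z (a j) *: e a], hence [x * e a] is [chi a x *: e a] modulo
[I] for all [x].  An [x] in the radical is killed by all [chi a], so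
[x = \sum_a x * e a] is in [I] ([radical_ideal_gen_T]).

Simple modules.  The radical kills a simple module [M], so each [T i] does.  As
the [e a] sum to [1], some [e a] does not kill [M], and a nonzero vector of
[e a M] is an eigenvector of character [chi a] ([simple_eigenvector]); it spans
[M].  The [r ^ n] characters differ on the [t j], so they give non-isomorphic
modules. *)

(** * Simple modules and maximal left ideals *)

Section SimpleModules.
Variable A : nzRingType.
Implicit Types (M : lmodType A) (I : set A).

Lemma left_ideal1 I : left_ideal I -> I 1 -> I = setT.
Proof.
by case=> _ _ IM I1; apply/seteqP; split=> // x _; rewrite -[x]mulr1; apply: IM.
Qed.

Lemma maximal_left_ideal1 I : maximal_left_ideal I -> ~ I 1.
Proof. by case=> lI IT _ /(left_ideal1 lI). Qed.

(** A left ideal strictly above the annihilator moves [m] onto a nonzero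
submodule, hence onto all of [M]; it then contains some [a] fixing [m], and
[1 - a] annihilates [m]. *)
Lemma simple_ann_maximal M (m : M) : simple_module M -> m != 0 ->
  maximal_left_ideal [set a | a *: m = 0].
Proof.
move=> [_ sM] m0; split.
- split=> /= [|x y xm ym|a x xm]; first by rewrite scale0r.
    by rewrite scalerDl xm ym addr0.
  by rewrite -[a *: x]/(a * x) -scalerA xm scaler0.
- move/seteqP=> [_ /(_ 1 I)] /= /eqP; rewrite scale1r; exact/negP.
move=> J lJ annJ; have [J0 JD JM] := lJ.
have sub : submodule [set y | exists2 a, J a & y = a *: m].
  split=> /= [|_ _ [a Ja ->] [b Jb ->]|c _ [a Ja ->]].
  - by exists 0; rewrite ?scale0r.
  - by exists (a + b); [exact: JD|rewrite scalerDl].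
  - by exists (c * a); [exact: JM|rewrite scalerA].
case: (sM _ sub) => [/seteqP[Jm0 _]|/seteqP[_ /(_ m I)] /= [a Ja ma]]; [left|right].
  apply/seteqP; split=> // a Ja /=; apply: Jm0; by exists a.
apply: left_ideal1 => //; rewrite -(subrK a 1); apply: JD => //.
by apply: annJ; rewrite /= scalerBl -ma scale1r subrr.
Qed.

Lemma radical_kills_simple M (a : A) (m : M) :
  simple_module M -> jacobson_radical A a -> a *: m = 0.
Proof.
move=> sM Ja; have [->|m0] := eqVneq m 0; first exact: scaler0.
by have := Ja _ (simple_ann_maximal sM m0).
Qed.

Lemma simple_span M (m x : M) : simple_module M -> m != 0 ->
  exists a : A, x = a *: m.
Proof.
move=> [_ sM] m0.
have sub : submodule [set y | exists a, y = a *: m].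
  split=> /= [|_ _ [a ->] [b ->]|c _ [a ->]].
  - by exists 0; rewrite scale0r.
  - by exists (a + b); rewrite scalerDl.
  - by exists (c * a); rewrite scalerA.
case: (sM _ sub) => /seteqP[]; last by move=> _ /(_ x I).
move=> /(_ m) /= m00 _; case/eqP: m0; apply: m00; by exists 1; rewrite scale1r.
Qed.

End SimpleModules.

(** * One-dimensional modules *)

Section Characters.
Variables (K : fieldType) (A : algType K).
Implicit Type chi : {rmorphism A -> K}.

Lemma scalar_actC (M : lmodType A) (a : A) (c : K) (m : M) :
  a *: (c%:A *: m) = c%:A *: (a *: m).
Proof. by rewrite [LHS]scalerA [RHS]scalerA mulr_algl mulr_algr. Qed.

Lemma scalar_actM (M : lmodType A) (c d : K) (m : M) :
  (c * d)%:A *: m = c%:A *: (d%:A *: m).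
Proof. by rewrite [RHS]scalerA mulr_algl scalerA. Qed.

(** A copy of [K] tagged by [chi], so that the action [a *: x = chi a * x] can be
inferred from the type. *)
Definition char_module chi : Type := K.

Section CharModule.
Variable chi : {rmorphism A -> K}.
HB.instance Definition _ := GRing.Zmodule.on (char_module chi).
Let act (a : A) (x : char_module chi) : char_module chi := chi a * (x : K).
Let actA a b x : act a (act b x) = act (a * b) x.
Proof. by rewrite /act mulrA rmorphM. Qed.
Let act1 : left_id 1 act. Proof. by move=> x; rewrite /act rmorph1 mul1r. Qed.
Let actDr : right_distributive act +%R.
Proof. by move=> a x y; exact: mulrDr. Qed.
Let actDl x : {morph act^~ x : a b / a + b}.
Proof. by move=> a b; rewrite /act rmorphD; exact: mulrDl. Qed.
HB.instance Definition _ :=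
  GRing.Zmodule_isLmodule.Build A (char_module chi) actA act1 actDr actDl.

Lemma char_moduleE (a : A) (x : char_module chi) : a *: x = chi a * x :> K.
Proof. by []. Qed.

Hypothesis chiK : forall c : K, chi c%:A = c.

Lemma char_module_simple : simple_module (char_module chi).
Proof.
split; first by exists (1 : K); exact: oner_neq0.
move=> N [N0 _ NZ]; have [[x [Nx x0]]|/forallNP noN] :=
  pselect (exists x : char_module chi, N x /\ x != 0); [right|left].
  apply/seteqP; split=> // y _; have -> : y = ((y : K) / x)%:A *: x :> char_module chi.
    by rewrite char_moduleE chiK mulfVK.
  exact: NZ.
apply/seteqP; split=> [x Nx|_ -> //]; apply/eqP/negPn/negP => x0.
by apply: (noN x).
Qed.

Lemma char_ker_maximal : maximal_left_ideal [set x | chi x = 0].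
Proof.
split.
- split=> /= [|x y cx cy|a x cx]; first exact: rmorph0.
    by rewrite rmorphD cx cy addr0.
  by rewrite -[a *: x]/(a * x) rmorphM cx mulr0.
- move/seteqP=> [_ /(_ 1 I)] /= /eqP; rewrite rmorph1; apply/negP; exact: oner_neq0.
move=> J lJ kerJ; have [_ JD JM] := lJ.
have [[x [Jx x0]]|/forallNP noJ] := pselect (exists x, J x /\ chi x != 0).
  right; apply: left_ideal1 => //; rewrite -(subrK ((chi x)^-1%:A * x) 1).
  apply: JD; last exact: JM.
  by apply: kerJ => /=; rewrite rmorphB rmorphM chiK rmorph1 mulVf ?subrr.
left; apply/seteqP; split=> // x Jx; apply/eqP/negPn/negP => x0.
by apply: (noJ x).
Qed.

Variable M : lmodType A.

(** All of [M] is spanned by [v] over [A], hence over [K]; the coordinate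
along [v] is the isomorphism. *)
Lemma eigenvector_basis (v : M) : simple_module M -> v != 0 ->
  (forall a, a *: v = (chi a)%:A *: v) ->
  has_dim M 1 /\ module_iso M (char_module chi).
Proof.
move=> sM v0 chiv.
have scal_inj (c d : K) : c%:A *: v = d%:A *: v -> c = d.
  move=> /eqP; rewrite -subr_eq0 -!scalerBl => /eqP cd.
  apply/eqP; rewrite -subr_eq0; apply: contraNT v0 => cd0.
  have <- : ((c - d)^-1%:A * (c - d)%:A) *: v = v.
    by rewrite mulr_algl scalerA mulVf // !scale1r.
  by rewrite -scalerA cd scaler0.
have spanv x : exists c : K, x = c%:A *: v.
  by have [a ->] := simple_span x sM v0; exists (chi a).
have chiM a (x : M) : a *: x = (chi a)%:A *: x.
  have [c ->] := spanv x.
  by rewrite scalar_actC chiv scalar_actC.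
split.
  exists (fun=> v) => x; have [c ->] := spanv x; exists [ffun=> c].
  split; first by rewrite big_ord1 ffunE.
  move=> d; rewrite big_ord1 => /scal_inj cd; apply/ffunP=> i.
  by rewrite ffunE (ord1 i).
have [g gE] := choice spanv.
pose h : M -> char_module chi := g.
have h_lin : linear h.
  move=> a x y; apply: scal_inj; rewrite /h -gE chiM !scalerDl.
  by rewrite char_moduleE scalar_actM -!gE.
pose G := GRing.isLinear.Build A M (char_module chi) *:%R h h_lin.
pose gL : {linear M -> char_module chi} := HB.pack h G.
exists gL; exists (fun c : K => c%:A *: v) => [x|c]; first by rewrite /= -gE.
by apply: scal_inj; rewrite /= -gE.
Qed.

Variables (N : set M) (v : M).
Hypothesis subN : submodule N.

(** With the next lemma, this makes being an eigenvector modulo a submodule a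
condition on algebra generators only. *)
Lemma eigen_add a b : N (a *: v - (chi a)%:A *: v) ->
  N (b *: v - (chi b)%:A *: v) -> N ((a + b) *: v - (chi (a + b))%:A *: v).
Proof.
have [_ ND _] := subN; move=> Na Nb.
by rewrite rmorphD /= !scalerDl opprD addrACA; apply: ND.
Qed.

Lemma eigen_mul a b : N (a *: v - (chi a)%:A *: v) ->
  N (b *: v - (chi b)%:A *: v) -> N ((a * b) *: v - (chi (a * b))%:A *: v).
Proof.
have [_ ND NZ] := subN; move=> Na Nb.
have -> : (a * b) *: v - (chi (a * b))%:A *: v =
    a *: (b *: v - (chi b)%:A *: v) + (chi b)%:A *: (a *: v - (chi a)%:A *: v).
  rewrite rmorphM mulrC scalar_actM.
  have -> : a *: (b *: v - (chi b)%:A *: v) =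
    (a * b) *: v - (chi b)%:A *: (a *: v).
    by rewrite [LHS]scalerBr scalar_actC [in LHS]scalerA.
  have -> : (chi b)%:A *: (a *: v - (chi a)%:A *: v) =
    (chi b)%:A *: (a *: v) - (chi b)%:A *: ((chi a)%:A *: v).
    exact: scalerBr.
  by rewrite subrKA.
by apply: ND; apply: NZ.
Qed.

End CharModule.

(** The action on any nonzero vector of the module recovers the character. *)
Lemma char_module_iso (chi chi' : {rmorphism A -> K}) :
  (forall c : K, chi c%:A = c) -> (forall c : K, chi' c%:A = c) ->
  module_iso (char_module chi) (char_module chi') -> chi =1 chi'.
Proof.
move=> chiK chiK' [f [g gK _]] y.
pose u : char_module chi := (1 : K).
have fu : f u != 0.
  apply/eqP => fu0; have : g (f u) = g (f 0) by rewrite fu0 linear0.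
  by rewrite !gK => /eqP; apply/negP; exact: oner_neq0.
have yu : y *: u = (chi y)%:A *: u.
  exact: (congr1 (fun c => c * (1 : K)) (esym (chiK (chi y)))).
have fyu : y *: f u = (chi y)%:A *: f u.
  by rewrite -[LHS]linearZ yu [LHS]linearZ.
apply: (mulIf fu); rewrite -[X in X * _]chiK'.
exact: (esym fyu).
Qed.

End Characters.

(** * Long words in nilpotent generators with braid relations vanish *)

Section NilCoxeter.
Variables (A : nzRingType) (T : nat -> A).
Hypothesis T_far : forall i j, (i.+1 < j)%N -> T i * T j = T j * T i.
Hypothesis T_braid : forall i, T i * T i.+1 * T i = T i.+1 * T i * T i.+1.
Hypothesis T_sq : forall i, T i * T i = 0.

(** The descending run [T k.-1 * T k.-2 * ... * T (k - l)], of length [l]; only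
[l <= k] is meaningful. *)
Fixpoint desc (k l : nat) : A :=
  if k isn't k'.+1 then 1 else if l isn't l'.+1 then 1 else T k' * desc k' l'.

Lemma desc_comm k l i : (i.+1 + l < k)%N || (k < i)%N ->
  desc k l * T i = T i * desc k l.
Proof.
elim: k l => [|k IH] [|l] ki /=; rewrite ?mul1r ?mulr1 //.
rewrite -mulrA IH; last by lia.
rewrite !mulrA; congr (_ * _).
by case/orP: ki => ki; [rewrite -T_far //|rewrite T_far //]; lia.
Qed.

Lemma desc_ext k l : (l < k)%N -> desc k l * T (k - l.+1) = desc k l.+1.
Proof.
elim: k l => // k IH [|l] lk /=; last by rewrite subSS -mulrA IH.
by rewrite subn1 mul1r; case: k {IH lk} => [|k]; rewrite /= mulr1.
Qed.

Lemma desc_sq k l : (0 < l <= k)%N -> desc k l * T (k - l) = 0.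
Proof.
case: l => // l lk; rewrite -desc_ext; last by lia.
by rewrite -mulrA T_sq mulr0.
Qed.

(** Inside the run, [T i.+1 * T i * T i.+1] turns into [T i * T i.+1 * T i]
whose first factor then commutes with the letters on its left, all of index above
[i.+1]. *)
Lemma desc_braid k l i : (l <= k)%N -> (k - l <= i)%N -> (i.+1 < k)%N ->
  desc k l * T i.+1 = T i * desc k l.
Proof.
elim: k l i => // k IH [|l] i lk li ik; first by lia.
move: ik; rewrite ltnS leq_eqVlt => /orP[/eqP ik|ik] /=; last first.
  by rewrite -mulrA IH // !mulrA -T_far //; lia.
subst k; case: l lk li => [|l] lk li; first by lia.
rewrite /= -!mulrA desc_comm; last by lia.
by rewrite !mulrA T_braid.
Qed.

(** [x] is a product of [k] runs of total length [L], the [j]-th one starting at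
the generator [j.-1]: this is the factorization of a permutation along the coset
representatives of the chain of symmetric groups. *)
Fixpoint normal (k L : nat) (x : A) : Prop :=
  if k isn't k'.+1 then L = 0 /\ x = 1 else
  exists y l L', [/\ (l <= k)%N, normal k' L' y, L = (L' + l)%N & x = y * desc k l].

Lemma normal_length k L x : normal k L x -> (L <= k * k)%N.
Proof.
elim: k L x => [|k IH] L x /=; first by case=> ->.
by move=> [y [l [L' [lk /IH L'k -> _]]]]; lia.
Qed.

Lemma normal1 k : normal k 0 1.
Proof.
elim: k => //= k IH; exists 1, 0, 0; split=> //=; by rewrite mulr1.
Qed.

(** Multiplying the last run by [T i] extends it, gives zero, or lets a letter
other than the topmost generator through to its left, where the induction
hypothesis applies. *)
Lemma normal_mulr k L x i : (i < k)%N -> normal k L x ->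
  x * T i = 0 \/ normal k L.+1 (x * T i).
Proof.
elim: k L x i => // k IH L x i ik [y [l [L' [lk yn -> ->]]]].
have step j : (j < k)%N -> desc k.+1 l * T i = T j * desc k.+1 l ->
    y * desc k.+1 l * T i = 0 \/
    normal k.+1 (L' + l).+1 (y * desc k.+1 l * T i).
  move=> jk E; rewrite -mulrA E mulrA.
  have [->|yjn] := IH _ _ _ jk yn; first by left; rewrite mul0r.
  by right; exists (y * T j), l, L'.+1; split.
(* The last letter of the run is [T (k.+1 - l)]; the case [i + l = k] is the one
   that extends the run. *)
have [il|il|il] := ltngtP (i + l) k.
- by apply: (step i); [lia|apply: desc_comm; lia].
- have [il1|il1] := leqP (i + l) k.+1.
    left; rewrite -mulrA (_ : i = k.+1 - l)%N; last by lia.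
    by rewrite desc_sq ?mulr0 //; lia.
  case: i ik il il1 step => [|i] ik il il1 step; first by lia.
  by apply: (step i); [lia|apply: desc_braid; lia].
- right; exists y, l.+1, L'; split=> //; [by lia|by rewrite addnS|].
  by rewrite -mulrA -desc_ext; [congr (_ * (_ * T _)); lia|lia].
Qed.

Lemma nilCoxeter_nilpotent k s : all (fun i => i < k)%N s ->
  (k * k < size s)%N -> \prod_(i <- s) T i = 0.
Proof.
move=> sk ks; suff : \prod_(i <- s) T i = 0 \/ normal k (size s) (\prod_(i <- s) T i).
  by case=> // /normal_length; lia.
elim/last_ind: s sk {ks} => [|s i IH]; first by rewrite big_nil; right; exact: normal1.
rewrite all_rcons size_rcons -cats1 big_cat big_seq1 /= => /andP[ik /IH[->|]].
  by left; rewrite mul0r.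
exact: normal_mulr.
Qed.
End NilCoxeter.

(** * Interpolation at the roots of unity *)

(** The polynomial ['X^r - 1] is separable because [r] is invertible. *)
Lemma roots_of_unity (K : closedFieldType) (r : nat) : r%:R != 0 :> K ->
  exists z : 'I_r -> K, injective z /\ \prod_i ('X - (z i)%:P) = 'X^r - 1.
Proof.
move=> r0; have r_gt0 : (0 < r)%N by case: r r0 => //; rewrite eqxx.
have [s sE] := closed_field_poly_normal ('X^r - 1 : {poly K}).
move: sE; rewrite (monicP (monicXnsubC 1 r_gt0)) scale1r => sE.
have sz : size s = r.
  by have := size_prod_XsubC s id; rewrite -sE size_XnsubC // => -[].
have us : uniq s by rewrite -separable_prod_XsubC -sE; exact: separable_Xn_sub_1.
subst r; exists (tnth (in_tuple s)); split; first exact/tuple_uniqP.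
by rewrite sE (big_tnth _ _ s); apply: eq_bigr.
Qed.

Section RootsOfUnity.
Variables (K : fieldType) (r : nat) (z : 'I_r -> K).
Hypothesis r_gt0 : (0 < r)%N.
Hypotheses (z_inj : injective z) (zE : \prod_i ('X - (z i)%:P) = 'X^r - 1).

Lemma root_of_unity_expr i : z i ^+ r = 1.
Proof.
apply/eqP; rewrite -subr_eq0; have : root ('X^r - 1) (z i).
  by rewrite -zE (bigD1 i) //= rootM root_XsubC eqxx.
by rewrite /root !hornerE.
Qed.

Definition lagrange_poly i : {poly K} :=
  (\prod_(j | j != i) (z i - z j))^-1 *: \prod_(j | j != i) ('X - (z j)%:P).

Lemma lagrange_poly_eval i j : (lagrange_poly i).[z j] = (i == j)%:R.
Proof.
rewrite hornerZ horner_prod; have [<-|ij] := eqVneq i j.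
  under [X in _ * X]eq_bigr do rewrite hornerXsubC.
  rewrite mulVf //; apply/prodf_neq0 => k ki.
  by rewrite subr_eq0 inj_eq // eq_sym.
by rewrite [X in _ * X](bigD1 j) 1?eq_sym //= hornerXsubC subrr mul0r mulr0.
Qed.

(** Both sides have degree less than [r] and agree at the [r] points [z i]. *)
Lemma sum_lagrange_poly : \sum_i lagrange_poly i = 1.
Proof.
apply/eqP; rewrite -subr_eq0; apply/eqP.
apply: (@roots_geq_poly_eq0 _ _ [seq z i | i : 'I_r]).
- apply/allP=> _ /mapP[j _ ->]; rewrite /root hornerD hornerN hornerC horner_sum.
  rewrite (bigD1 j) //= lagrange_poly_eval eqxx big1 ?addr0 ?subrr //= => i ij.
  by rewrite lagrange_poly_eval (negPf ij).
- by rewrite map_inj_uniq ?enum_uniq.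
rewrite size_map size_enum_ord (leq_trans (size_polyD _ _)) // geq_max size_polyN.
rewrite size_poly1 r_gt0 andbT; apply: (leq_trans (size_sum _ _ _)).
apply/bigmax_leqP=> i _; apply: (leq_trans (size_scale_leq _ _)).
rewrite size_prod => [|j _]; last by rewrite polyXsubC_eq0.
under eq_bigr do rewrite size_XsubC.
by rewrite sum_nat_const cardC1 card_ord; lia.
Qed.

Lemma lagrange_poly_root i : ('X - (z i)%:P) * lagrange_poly i =
  (\prod_(j | j != i) (z i - z j))^-1 *: ('X^r - 1).
Proof. by rewrite -zE -scalerAr; congr (_ *: _); rewrite [RHS](bigD1 i). Qed.
End RootsOfUnity.

(** * Simultaneous eigenprojectors of commuting roots of unity *)

Section Idempotents.
Variables (K : fieldType) (A : algType K) (r n : nat) (z : 'I_r -> K).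
Hypothesis r_gt0 : (0 < r)%N.
Hypotheses (z_inj : injective z) (zE : \prod_i ('X - (z i)%:P) = 'X^r - 1).
Variable t : 'I_n -> A.
Hypotheses (tX : forall j, t j ^+ r = 1) (tC : forall j k, t j * t k = t k * t j).

(* The projector onto the [z i]-eigenspace of [t j]. *)
Let E j i : A := horner_alg (t j) (lagrange_poly z i).

Let mulE j i : t j * E j i = z i *: E j i.
Proof.
apply/eqP; rewrite -subr_eq0 -mulr_algl -mulrBl -{1}[t j]horner_algX.
rewrite -(horner_algC (t j)) -rmorphB -rmorphM /= lagrange_poly_root // linearZ /=.
by rewrite rmorphB rmorphXn /= horner_algX tX rmorph1 subrr mulr0.
Qed.

Let commE j k i : t j * E k i = E k i * t j.
Proof.
rewrite /E; elim/poly_ind: (lagrange_poly z i) => [|p c IH].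
  by rewrite rmorph0 mulr0 mul0r.
rewrite rmorphD rmorphM /= horner_algX horner_algC mulrDr mulrDl mulr_algl mulr_algr.
by congr (_ + _); rewrite mulrA IH -!mulrA tC.
Qed.

(** The projector onto the common eigenspace where [t j] acts by [z (a j)]. *)
Definition torus_idem (a : {ffun 'I_n -> 'I_r}) : A := \prod_j E j (a j).

Lemma sum_torus_idem : \sum_a torus_idem a = 1.
Proof.
rewrite -(bigA_distr_bigA E) big1 // => j _.
by rewrite /E -rmorph_sum sum_lagrange_poly // rmorph1.
Qed.

Lemma torus_idem_eigen a j : t j * torus_idem a = z (a j) *: torus_idem a.
Proof.
have /(_ (index_enum _)) : forall s, j \in s ->
    t j * \prod_(k <- s) E k (a k) = z (a j) *: \prod_(k <- s) E k (a k).
  elim=> // k s IH; rewrite !big_cons inE; have [<- _|jk /= js] := eqVneq j k.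
    by rewrite mulrA mulE scalerAl.
  by rewrite mulrA commE -mulrA IH // scalerAr.
by apply; rewrite mem_index_enum.
Qed.
End Idempotents.

(** * Algebras generated by a torus and normalizing nilpotents

The arguments about the radical and the simple modules are carried out in any
algebra generated by elements [t j] and [T i] related as below, with long words
in the [T i] equal to zero. *)

Section NilpotentByTorus.
Variables (K : fieldType) (A : algType K) (m n r : nat).
Variables (T : 'I_m -> A) (t : 'I_n -> A) (s : 'I_m -> 'I_n -> 'I_n).
Hypothesis gen : forall P : A -> Prop,
  (forall c : K, P c%:A) -> (forall x y, P x -> P y -> P (x + y)) ->
  (forall x y, P x -> P y -> P (x * y)) ->
  (forall i, P (T i)) -> (forall j, P (t j)) -> forall x, P x.
Hypotheses (tX : forall j, t j ^+ r = 1) (tC : forall j k, t j * t k = t k * t j).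
Hypothesis Tt : forall i j, T i * t j = t (s i j) * T i.
Variable N : nat.
Hypothesis nilT : forall w : seq 'I_m, (N < size w)%N -> \prod_(i <- w) T i = 0.

(** If the left ideal [J] below were [I] itself, an element outside [I] would
stay outside after multiplication by a suitable [T i], over and over, against the
vanishing of long words. *)
Lemma maximal_left_ideal_T (I : set A) i y : maximal_left_ideal I -> I (T i * y).
Proof.
move=> maxI; have [lI IT maxIP] := maxI; have [I0 ID IM] := lI.
pose J := [set x | forall i, I (T i * x)].
have lJ : left_ideal J.
  split=> [k|x x' Jx Jx' k|b x Jx]; rewrite ?mulr0 ?mulrDr //; first exact: ID.
  rewrite -[b *: x]/(b * x).
  elim/gen: b x Jx => [c|b b' IHb IHb'|b b' IHb IHb'|k|j] x Jx k'.
  - by rewrite mulr_algl -scalerAr -mulr_algl; apply: IM.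
  - by rewrite mulrDl mulrDr; apply: ID; [apply: IHb|apply: IHb'].
  - by rewrite -mulrA; apply: IHb => k; apply: IHb'.
  - by apply: IM; apply: Jx.
  - by rewrite mulrA Tt -mulrA; apply: IM; apply: Jx.
have [JI|JT] := maxIP J lJ (fun x Ix k => IM _ _ Ix); last first.
  by have : J y; [rewrite JT|apply].
suff word l : exists2 w : seq 'I_m, size w = l & ~ I (\prod_(k <- w) T k).
  have [w wN []] := word N.+1.
  by rewrite nilT ?wN.
elim: l => [|l [w <- Iw]].
  exists [::] => //; rewrite big_nil; exact: maximal_left_ideal1.
have /existsNP[k Ik] : ~ J (\prod_(k <- w) T k) by rewrite JI.
by exists (k :: w) => //; rewrite big_cons.
Qed.

Lemma T_radical i : jacobson_radical A (T i).
Proof. by move=> I maxI; rewrite -[T i]mulr1; apply: maximal_left_ideal_T. Qed.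

Lemma ideal_gen_T_radical : ideal_gen (range T) `<=` jacobson_radical A.
Proof.
move=> x Ix I maxI; have [[I0 ID IM] _ _] := maxI.
(* The largest two-sided ideal inside [I]. *)
pose core := [set x | forall y, I (x * y)].
have core_ideal : two_sided_ideal core.
  split=> [y|u u' Iu Iu' y|a u Iu y|a u Iu y]; first by rewrite mul0r.
  - by rewrite mulrDl; apply: ID.
  - by rewrite -mulrA; apply: IM.
  - by rewrite -mulrA; apply: Iu.
rewrite -[x]mulr1; apply: (Ix core); split=> // _ [i _ <-] y.
exact: maximal_left_ideal_T.
Qed.

(** Used with [L] zero to find eigenvectors in simple modules, and with [M] the
regular module and [L] an ideal to compute modulo that ideal. *)
Lemma character_eigen (chi : {rmorphism A -> K}) (M : lmodType A) (L : set M)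
    (v : M) :
    (forall c : K, chi c%:A = c) -> submodule L ->
    (forall i, L (T i *: v - (chi (T i))%:A *: v)) ->
    (forall j, L (t j *: v - (chi (t j))%:A *: v)) ->
  forall y, L (y *: v - (chi y)%:A *: v).
Proof.
move=> chiK subL LT Lt; apply: gen => // [c|x y|x y].
- by rewrite chiK subrr; case: subL.
- exact: eigen_add.
- exact: eigen_mul.
Qed.

Variable z : 'I_r -> K.
Hypothesis r_gt0 : (0 < r)%N.
Hypotheses (z_inj : injective z) (zE : \prod_i ('X - (z i)%:P) = 'X^r - 1).
Variable chi : {ffun 'I_n -> 'I_r} -> {rmorphism A -> K}.
Hypothesis chiK : forall a (c : K), chi a c%:A = c.
Hypothesis chiT : forall a i, chi a (T i) = 0.
Hypothesis chit : forall a j, chi a (t j) = z (a j).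

Local Notation e := (torus_idem z t).

Let sum_e : \sum_a e a = 1. Proof. exact: sum_torus_idem. Qed.
Let t_e a j : t j * e a = z (a j) *: e a.
Proof. exact: torus_idem_eigen. Qed.

(** Modulo the ideal, [x] acts on [e a] by [chi a x], which is zero when [x] is
in the radical, and the [e a] sum to [1]. *)
Lemma radical_ideal_gen_T : jacobson_radical A = ideal_gen (range T).
Proof.
apply/seteqP; split; last exact: ideal_gen_T_radical.
have [I0 ID IMl IMr] := ideal_gen_ideal (range T).
have lI : left_ideal (ideal_gen (range T)) by [].
move=> x Jx; rewrite -[x]mulr1 -sum_e mulr_sumr; apply: big_ind => // a _.
have chix : chi a x = 0 by have := Jx _ (char_ker_maximal (chiK a)).
have := @character_eigen (chi a) A^o _ (e a) (chiK a) lI _ _ x.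
rewrite chix scale0r scale0r subr0; apply=> [i|j].
  rewrite chiT scale0r scale0r subr0; apply: IMr => I [_]; apply; by exists i.
by rewrite chit -[X in X - _]/(t j * e a) t_e -[X in _ - X]/(_ * _) mulr_algl subrr.
Qed.

(** Some [e a] does not kill [M], as they sum to [1]; any nonzero vector in its
image will do, the [T i] being in the radical. *)
Lemma simple_eigenvector (M : lmodType A) : simple_module M ->
  exists a (v : M), v != 0 /\ forall y, y *: v = (chi a y)%:A *: v.
Proof.
move=> sM; have [[m0 m0_neq0] _] := sM.
have [a ea] : exists a, e a *: m0 != 0.
  apply: contrapT => /forallNP em; case/eqP: m0_neq0.
  rewrite -[m0]scale1r -sum_e scaler_suml big1 // => a _.
  by apply/eqP/negPn/negP/em.
exists a, (e a *: m0); split=> // y; apply/eqP; rewrite -subr_eq0; apply/eqP.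
apply: (@character_eigen (chi a) M [set 0]) => //=.
- split=> //= [x x' -> ->|b x ->]; by rewrite ?addr0 ?scaler0.
- move=> i; rewrite chiT scale0r scale0r subr0.
  exact: radical_kills_simple (T_radical i).
- move=> j; rewrite chit.
  have -> : t j *: (e a *: m0) = (z (a j))%:A *: (e a *: m0).
    by rewrite [LHS]scalerA t_e [RHS]scalerA mulr_algl.
  exact: subrr.
Qed.

Lemma simple_dim1 (M : lmodType A) : simple_module M -> has_dim M 1.
Proof.
move=> sM; have [a [v [v0 va]]] := simple_eigenvector sM.
by have [] := eigenvector_basis sM v0 va.
Qed.

Lemma num_simple : num_simple_modules A (r ^ n).
Proof.
have cardE : (r ^ n = #|{ffun 'I_n -> 'I_r}|)%N by rewrite card_ffun !card_ord.
pose idx (i : 'I_(r ^ n)) : {ffun 'I_n -> 'I_r} := enum_val (cast_ord cardE i).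
exists (fun i => char_module (chi (idx i))); split=> [i|i j|M sM].
- exact: char_module_simple.
- move/char_module_iso => /(_ (chiK _) (chiK _)) chi_ij.
  apply: (@cast_ord_inj _ _ cardE); apply: enum_val_inj.
  by apply/ffunP=> k; apply: z_inj; rewrite -!chit chi_ij.
- have [a [v [v0 va]]] := simple_eigenvector sM.
  exists (cast_ord (esym cardE) (enum_rank a)).
  by rewrite /idx cast_ordKV enum_rankK; have [] := eigenvector_basis sM v0 va.
Qed.
End NilpotentByTorus.

(** * The nil Yokonuma-Hecke algebra *)

Section NilYH.
Variables (K : fieldType) (r n : nat).
Local Notation Y := (nilYH K r n).
Local Notation T := (@nilYH_T K r n).
Local Notation t := (@nilYH_t K r n).

Lemma nilYH_ind (P : Y -> Prop) :
    (forall c : K, P c%:A) -> (forall x y, P x -> P y -> P (x + y)) ->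
    (forall x y, P x -> P y -> P (x * y)) ->
    (forall i, P (T i)) -> (forall j, P (t j)) ->
  forall x, P x.
Proof.
move=> PC PD PM PT Pt x; have [u ->] := quot_pi_surj x.
have P0 : P 0 by have := PC 0; rewrite scale0r.
pose pi := quot_pi (nilYH_ideal K r n).
have piZ (c : K) (y : free_alg K (nilYH_gen n)) : pi (c *: y) = c%:A * pi y.
  by rewrite mulr_algl /pi linearZ.
rewrite (monalgE u) raddf_sum; apply: big_ind => // k _.
have -> : << u@_k *g k >> = u@_k *: (<< k >> : free_alg K (nilYH_gen n)).
  by rewrite -[RHS]mul_malgC malgM_def fgmulUU mul1m mulr1.
suff : P (pi (u@_k *: (<< k >> : free_alg K (nilYH_gen n)))) by [].
rewrite piZ; apply: (PM) => //.
rewrite -(fmK k); elim: (fmonom_val k) => [|g s IH].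
  by have := PC 1; rewrite scale1r -(rmorph1 pi) -fmoneE.
have -> : pi << FMonom (g :: s) >> = pi (free_gen K g) * pi << FMonom s >>.
  rewrite /pi -rmorphM; congr quot_pi; rewrite [RHS]malgM_def fgmulUU mulr1.
  by congr << _ >>; apply/eqP; rewrite fmP fmM fmuE.
by apply: PM => //; case: g.
Qed.

(** The evaluation of the free algebra at [0] and the [a j] kills the relators. *)
Lemma nilYH_character (a : 'I_n -> K) : (forall j, a j ^+ r = 1) ->
  exists chi : {rmorphism Y -> K},
    [/\ forall c : K, chi c%:A = c, forall i, chi (T i) = 0
      & forall j, chi (t j) = a j].
Proof.
move=> ar; pose f (g : nilYH_gen n) : K := if g is inr j then a j else 0.
pose ev : {lrmorphism free_alg K (nilYH_gen n) -> K | *%R} := mmap idfun (word_eval f).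
have evE g : ev (free_gen K g) = f g.
  by rewrite /ev /= /free_gen mmapU /= mul1r /word_eval fmuE big_seq1.
have ev_ideal : ideal_gen (@nilYH_relators K r n) `<=` [set x | ev x = 0].
  apply: smallest_sub; first exact: ker_ideal.
  move=> _ [u [v [uv ->]]] /=; rewrite rmorphB; apply/eqP; rewrite subr_eq0.
  apply/eqP; case: (nilYH_rel_morph ev uv) => [j|j k|i j|i k _|i k _|i] /=;
    rewrite ?evE /= ?ar ?mulr0 ?mul0r //; first exact: mulrC.
  by rewrite expr0n.
pose chi (y : Y) : K := ev (generic_quotient.repr y).
have chiE x : chi (quot_pi (nilYH_ideal K r n) x) = ev x.
  apply/eqP; rewrite -subr_eq0 -rmorphB; apply/eqP/ev_ideal.
  by apply: (quot_piE (nilYH_ideal K r n) _ _).1; exact: reprK.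
have pi_surj (y : Y) : exists x, y = quot_pi (nilYH_ideal K r n) x.
  exact: quot_pi_surj.
have chi_zmod : zmod_morphism chi.
  move=> x y; have [u ->] := pi_surj x; have [v ->] := pi_surj y.
  by rewrite -rmorphB !chiE rmorphB.
have chi_monoid : monoid_morphism chi.
  split=> [|x y]; first by rewrite -(rmorph1 (quot_pi (nilYH_ideal K r n))) chiE rmorph1.
  have [u ->] := pi_surj x; have [v ->] := pi_surj y.
  by rewrite -rmorphM !chiE rmorphM.
pose hA := GRing.isZmodMorphism.Build Y K chi chi_zmod.
pose hM := GRing.isMonoidMorphism.Build Y K chi chi_monoid.
pose chiR : {rmorphism Y -> K} := HB.pack chi hA hM.
exists chiR; split=> [c|i|j]; rewrite /chiR /=; [|by rewrite chiE evE..].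
rewrite -(rmorph1 (quot_pi (nilYH_ideal K r n))) -linearZ chiE linearZ rmorph1.
exact: mulr1.
Qed.

Lemma simple_refl_neq1 (i : 'I_n.-1) : simple_refl i != 1%g.
Proof.
apply/eqP => /permP/(_ (Ordinal (simple_refl_ltl i))) /(congr1 val).
by rewrite tpermL perm1 /=; lia.
Qed.

Lemma is_Tw_simple_refl i : is_Tw (simple_refl i) (T i).
Proof.
exists [:: i]; last by rewrite big_seq1.
split=> [|[|//]]; first by rewrite /word_perm big_seq1.
by rewrite /word_perm big_nil => /esym/eqP; rewrite (negPf (simple_refl_neq1 i)).
Qed.

(** A reduced word of [w != 1] is nonempty, so its product starts with some
[T i]; conversely [T i] is [T_w] for [w] a simple reflection. *)
Lemma ideal_gen_Tw :
  ideal_gen [set x | exists2 w : 'S_n, w != 1%g & is_Tw w x] = ideal_gen (range T).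
Proof.
apply/seteqP; split; apply: smallest_sub; try exact: ideal_gen_ideal.
  move=> x [w w1 [[|i s] [sw _] ->]].
    by case/eqP: w1; rewrite -sw /word_perm big_nil.
  have [_ _ _ IMr] := ideal_gen_ideal (range T).
  by rewrite big_cons; apply: IMr => I [_]; apply; exists i.
move=> _ [i _ <-] I [_]; apply; exists (simple_refl i).
  exact: simple_refl_neq1.
exact: is_Tw_simple_refl.
Qed.
End NilYH.

Lemma nilYH_nilpotent (K : fieldType) r n (s : seq 'I_n.-1) :
  (n.-1 * n.-1 < size s)%N -> \prod_(i <- s) nilYH_T K r i = 0.
Proof.
(* Out-of-range generators are set to zero, so that the relations hold for all
   indices in [nat]. *)
pose T i := oapp (nilYH_T K r (n := n)) 0 (insub i).
have TE (i : 'I_n.-1) : T i = nilYH_T K r i by rewrite /T valK.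
have Tout i : (n.-1 <= i)%N -> T i = 0 by move=> ni; rewrite /T insubN // -leqNgt.
move=> ns; have := @nilCoxeter_nilpotent _ T _ _ _ n.-1 (map val s).
rewrite big_map size_map; under eq_bigr do rewrite TE.
apply=> //.
- move=> i j ij; have [jn|/Tout->] := ltnP j n.-1; last by rewrite mulr0 mul0r.
  have i_n : (i < n.-1)%N by lia.
  rewrite (TE (Ordinal jn)) (TE (Ordinal i_n)); apply: nilYH_relP.
  by constructor; rewrite ij.
- move=> i; have [jn|/Tout->] := ltnP i.+1 n.-1; last by rewrite !(mulr0, mul0r).
  rewrite (TE (Ordinal jn)) (TE (Ordinal (ltnW jn))); apply: nilYH_relP.
  exact: nilYH_braid.
- move=> i; have [jn|/Tout->] := ltnP i n.-1; last by rewrite mul0r.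
  by rewrite (TE (Ordinal jn)) -expr2; apply: nilYH_relP; constructor.
- apply/allP=> _ /mapP[i _ ->]; exact: ltn_ord.
Qed.

Theorem proposition3p1 (K : closedFieldType) (r n : nat)
    (r_gt0 : (0 < r)%N) (n_gt0 : (0 < n)%N)
    (charK : forall p, p \in [pchar K] -> ~~ (p %| r)%N) :
  [/\ jacobson_radical (nilYH K r n)
         = ideal_gen [set x | exists2 w : 'S_n, w != 1%g & is_Tw w x],
      num_simple_modules (nilYH K r n) (r ^ n)
    & forall M : lmodType (nilYH K r n), simple_module M -> has_dim M 1].
Proof.
have rK : r%:R != 0 :> K.
  apply/negP=> r0; have [p pK] := natf0_pchar r_gt0 r0.
  by have := charK p pK; rewrite (dvdn_pcharf pK) r0.
have [z [z_inj zE]] := roots_of_unity rK.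
have chi_exists (a : {ffun 'I_n -> 'I_r}) :=
  nilYH_character (fun j => root_of_unity_expr zE (a j)).
have [chi chiP] := choice chi_exists.
have chiK a c : chi a c%:A = c by have [] := chiP a.
have chiT a i : chi a (nilYH_T K r i) = 0 by have [] := chiP a.
have chit a j : chi a (nilYH_t K r j) = z (a j) by have [] := chiP a.
have gen := @nilYH_ind K r n.
have tX j := nilYH_relP (nilYH_tX r (@nilYH_T K r n) (@nilYH_t K r n) j).
have tC j k := nilYH_relP (nilYH_tt r (@nilYH_T K r n) (@nilYH_t K r n) j k).
have Tt i j := nilYH_relP (nilYH_Tt r (@nilYH_T K r n) (@nilYH_t K r n) i j).
have nilT := @nilYH_nilpotent K r n.
split.
- rewrite ideal_gen_Tw.
  exact: (radical_ideal_gen_T gen tX tC Tt nilT r_gt0 z_inj zE chiK chiT chit).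
- exact: (num_simple gen tX tC Tt nilT r_gt0 z_inj zE chiK chiT chit).
- exact: (simple_dim1 gen tX tC Tt nilT r_gt0 z_inj zE chiK chiT chit).
Qed.
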